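(* The mean bubble size $\bar p$, taken over all bubbles on linear chord diagrams consisting of $2n$ vertices, is given by $$\bar p \equiv \frac{\sum_{p=1}^{2n} p\,B_{n,p}}{\sum_{p=1}^{2n} B_{n,p}} = \frac{2(2n-1)(n-1)}{4n-5}.$$
   Context: A linear chord diagram on $2n$ vertices is a perfect matching of the linearly ordered set of vertices $\{1,2,\dots,2n\}$; its $n$ pairs are called chords. A short chord is a chord joining two adjacent vertices $i,i+1$. A bubble of a linear chord diagram is a nonempty maximal set of consecutive vertices none of which is an endpoint of a short chord (so a bubble is bounded on each side by a short chord or by an end of the diagram; its vertices may be joined by non-short chords to one another or to vertices outside the bubble). The size of a bubble is the number of its vertices. $B_{n,p}$ denotes the total number of bubbles of size $p$, counted across all $(2n-1)!!$ linear chord diagrams on $2n$ vertices. *)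

(* Defs.v *)
From mathcomp Require Import all_boot all_order all_algebra.

Set Implicit Arguments.
Unset Strict Implicit.
Unset Printing Implicit Defensive.

(* The vertices 1, ..., 2n are represented by the ordinals 0, ..., 2n - 1. *)
Section ChordDiagrams.

Variable n : nat.
Implicit Types (M : {set {set 'I_(2 * n)}}) (c A : {set 'I_(2 * n)}).

Definition chord_diagram M : bool :=
  partition M [set: 'I_(2 * n)] && [forall c in M, #|c| == 2].

Definition short c : bool :=
  [exists i : 'I_(2 * n), exists j : 'I_(2 * n),
    (nat_of_ord j == i.+1) && (c == [set i; j])].

Definition short_endpoint M (v : 'I_(2 * n)) : bool :=
  [exists c in M, short c && (v \in c)].

Definition consecutive A : bool :=
  [forall i in A, forall k in A, forall j : 'I_(2 * n),
    (i <= j <= k) ==> (j \in A)].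

Definition bubble M A : bool :=
  maxset (fun A' : {set 'I_(2 * n)} =>
            [&& A' != set0, consecutive A' &
                [forall v in A', ~~ short_endpoint M v]]) A.

End ChordDiagrams.

Definition num_bubbles (n p : nat) : nat :=
  \sum_(M : {set {set 'I_(2 * n)}} | chord_diagram M)
    #|[set A | bubble M A & #|A| == p]|.

(* Main.v *)
Require Import Defs.
From mathcomp Require Import all_boot all_order all_algebra.
From mathcomp Require Import zify ring lra.

(** Write D_m = (2m-1)!! for the number of chord diagrams with m chords.

    Numerator.  The bubbles of a diagram partition its free vertices, those
    that are not endpoints of short chords ([runs_partition]).  So the
    numerator is the number of pairs (diagram, free vertex).  Deleting a
    prescribed chord leaves an arbitrary diagram on the other vertices, so each
    of the 2n-1 possible short chords lies in D_(n-1) diagrams, and it occupies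
    two vertices ([count_free]).  The numerator is therefore
    2n D_n - 2 (2n-1) D_(n-1) = (2n-2) D_n  ([total_free]).

    Denominator.  A bubble is determined by its first vertex, so it suffices to
    count pairs (diagram, start), where a start is a free vertex without a free
    predecessor ([card_runs]).  Vertex 0 is a start when the chord {0,1} is
    absent: D_n - D_(n-1) diagrams.  Vertex 1 is never a start, because the only
    short chord through 0 is {0,1}.  A vertex v >= 2 is a start exactly when
    {v-2,v-1} is a chord and {v,v+1} is not ([start_link]).  This gives
    D_(n-1) - D_(n-2) diagrams, or D_(n-1) when v is the last vertex and
    {v,v+1} does not exist ([count_start]).  The total is
    D_n - D_(n-1) + (2n-2) D_(n-1) - (2n-3) D_(n-2) = (4n-5) D_(n-1)
    ([total_starts]).

    The quotient is (2n-2) (2n-1) / (4n-5), since D_n = (2n-1) D_(n-1).  For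
    n = 1 there are no bubbles, and both sides are zero. *)

Set Implicit Arguments.
Unset Strict Implicit.
Unset Printing Implicit Defensive.

(** * Perfect matchings of a finite set *)

Section Matchings.
Variable T : finType.
Implicit Types (S c d : {set T}) (P Q : {set {set T}}).

Definition matchings S : {set {set {set T}}} :=
  [set P | partition P S && [forall c in P, #|c| == 2]].

Lemma matchingsP S P :
  reflect (partition P S /\ {in P, forall c, #|c| = 2}) (P \in matchings S).
Proof.
rewrite inE; apply: (iffP andP) => -[pP P2]; split=> //.
  by move=> c cP; apply/eqP; move: c cP; apply/forall_inP.
by apply/forall_inP=> c /P2->.
Qed.

Lemma card_chord S P c : P \in matchings S -> c \in P -> #|c| = 2.
Proof. by case/matchingsP=> _ P2 /P2. Qed.

Lemma chord_eq S P c d v : P \in matchings S -> c \in P -> d \in P ->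
  v \in c -> v \in d -> c = d.
Proof.
case/matchingsP=> /and3P[_ tP _] _ cP dP vc vd.
by rewrite -(def_pblock tP cP vc) (def_pblock tP dP vd).
Qed.

(** Removing the prescribed chord c and adjoining it again are inverse to each
    other; this reduces every count of matchings with prescribed chords to a
    count on a smaller set. *)
Lemma matchings_with S c : c \subset S -> #|c| = 2 ->
  [set P in matchings S | c \in P]
    = [set c |: Q | Q in matchings (S :\: c)].
Proof.
move=> cS c2; apply/setP=> P; apply/idP/imsetP.
  rewrite inE => /andP[PS cP]; exists (P :\ c); last by rewrite setD1K.
  case/matchingsP: PS => pP P2; apply/matchingsP; split.
    exact: partitionD1.
  by move=> d /setD1P[_ /P2].
case=> Q /matchingsP[pQ Q2] ->.
rewrite inE setU11 andbT; apply/matchingsP; split.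
  have := @partitionU1 _ _ _ c pQ; rewrite setDE setUIr setUCr setIT.
  rewrite (setUidPr cS); apply; first by rewrite -card_gt0 c2.
  by rewrite -setI_eq0 setICA setICr setI0.
by move=> d /setU1P[->|/Q2].
Qed.

Lemma chord_notin_matchings S c Q :
  #|c| = 2 -> Q \in matchings (S :\: c) -> c \notin Q.
Proof.
move=> c2 QS; apply/negP => cQ.
case/matchingsP: QS => /and3P[/eqP covQ _ _] _.
have cc : c \subset S :\: c by rewrite -covQ bigcup_sup.
have /card_gt0P[x xc] : 0 < #|c| by rewrite c2.
by have /setDP[_] := subsetP cc _ xc; rewrite xc.
Qed.

Lemma adjoin_chord_inj S c : #|c| = 2 ->
  {in matchings (S :\: c) &, injective (fun Q => c |: Q)}.
Proof.
move=> c2 Q Q' QS QS' eqQ.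
rewrite -(setU1K (chord_notin_matchings c2 QS)) eqQ setU1K //.
exact: chord_notin_matchings QS'.
Qed.

Lemma card_matchings_with S c : c \subset S -> #|c| = 2 ->
  #|[set P in matchings S | c \in P]| = #|matchings (S :\: c)|.
Proof.
by move=> cS c2; rewrite matchings_with // card_in_imset //; apply: adjoin_chord_inj.
Qed.

Lemma card_matchings_with2 S c d : c \subset S -> #|c| = 2 ->
    d \subset S :\: c -> #|d| = 2 ->
  #|[set P in matchings S | (c \in P) && (d \in P)]|
    = #|matchings (S :\: c :\: d)|.
Proof.
move=> cS c2 dS d2; rewrite -card_matchings_with //.
have -> : [set P in matchings S | (c \in P) && (d \in P)]
    = [set c |: Q | Q in [set Q in matchings (S :\: c) | d \in Q]].
  apply/setP=> P; apply/idP/imsetP.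
    case/setIdP=> PS /andP[cP dP].
    have: P \in [set P in matchings S | c \in P] by rewrite inE PS cP.
    rewrite matchings_with // => /imsetP[Q QS defP]; exists Q => //.
    rewrite inE QS; move: dP; rewrite defP => /setU1P[dc|//].
    have /card_gt0P[x xd] : 0 < #|d| by rewrite d2.
    by have := subsetP dS _ xd; rewrite -dc inE xd.
  case=> Q /setIdP[QS dQ] ->; rewrite inE andbA.
  have: c |: Q \in [set P in matchings S | c \in P].
    by rewrite matchings_with // imset_f.
  by case/setIdP=> -> ->; rewrite inE dQ orbT.
rewrite card_in_imset // => Q Q' /setIdP[QS _] /setIdP[QS' _].
exact: (adjoin_chord_inj c2 QS QS').
Qed.

Lemma matchings0 : matchings set0 = [set set0].
Proof.
apply/setP=> P; apply/matchingsP/set1P=> [[]|->]; rewrite partition_set0.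
  by move/eqP.
by split=> // c; rewrite inE.
Qed.

(** Lets the matchings of S be sorted by the chord through a fixed a. *)
Lemma partner_unique S P a : P \in matchings S -> a \in S ->
  \sum_(b in S :\ a) ([set a; b] \in P) = 1.
Proof.
move=> PS aS; have /matchingsP[/and3P[/eqP covP tP _] _] := PS.
have aP : a \in cover P by rewrite covP.
have cP := pblock_mem aP; have ac : a \in pblock P a by rewrite mem_pblock.
have /eqP/cards2P[x [y [xy defc]]] := card_chord PS cP.
(* The partner b of a is the other element of the block of a. *)
have [b ba defcb] : exists2 b, b != a & pblock P a = [set a; b].
  move: ac; rewrite defc !inE => /orP[]/eqP->.
    by exists y; rewrite // eq_sym.
  by exists x; rewrite // setUC.
have bS : b \in S :\ a.
  rewrite !inE ba -covP; apply/bigcupP; exists (pblock P a) => //.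
  by rewrite defcb !inE eqxx orbT.
rewrite (bigD1 b) //= -defcb cP big1 // => e /andP[/setD1P[ea _] eb].
apply/eqP; rewrite eqb0; apply/negP => eP.
have eqe : [set a; e] = pblock P a.
  by apply: (chord_eq (v := a) PS); rewrite // !inE eqxx.
have : e \in pblock P a by rewrite -eqe !inE eqxx orbT.
by rewrite defcb !inE (negPf ea) (negPf eb).
Qed.

(** The double factorial (2m-1)!!. *)
Definition odd_factorial m := \prod_(i < m) i.*2.+1.

(** A fixed vertex can be matched with any of the 2m-1 others, and what remains
    is a matching of 2m-2 vertices. *)
Theorem card_matchings m S : #|S| = m.*2 -> #|matchings S| = odd_factorial m.
Proof.
elim: m S => [|m IHm] S cardS.
  have -> : S = set0 by apply/eqP; rewrite -cards_eq0 cardS.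
  by rewrite matchings0 cards1 /odd_factorial big_ord0.
have /card_gt0P[a aS] : 0 < #|S| by rewrite cardS.
have cardSa : #|S :\ a| = m.*2.+1 by move: (cardsD1 a S); rewrite aS cardS; lia.
rewrite -sum1_card (eq_bigr (fun P => \sum_(b in S :\ a) ([set a; b] \in P)));
  last by move=> P PS; rewrite (partner_unique PS aS).
rewrite exchange_big /= (eq_bigr (fun => odd_factorial m)).
  by rewrite sum_nat_const cardSa /odd_factorial big_ord_recr /= mulnC.
move=> b /setD1P[ba bS].
have c2 : #|[set a; b]| = 2 by rewrite cards2 eq_sym ba.
have cS : [set a; b] \subset S by rewrite subUset !sub1set aS bS.
rewrite -big_mkcondr sum1dep_card card_matchings_with //; apply: IHm.
by move: (cardsD S [set a; b]); rewrite (setIidPr cS) c2 cardS; lia.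
Qed.

End Matchings.

(** * Maximal runs of consecutive vertices *)

Section Runs.
Variable n : nat.
Implicit Types (N A B : {set 'I_(2 * n)}) (u v : 'I_(2 * n)).

Definition runs N : {set {set 'I_(2 * n)}} :=
  [set A | maxset (fun A' => [&& A' != set0, consecutive A' & A' \subset N]) A].

Definition starts N : {set 'I_(2 * n)} :=
  [set v in N | [forall u in N, u.+1 != v]].

Lemma startsP N v :
  reflect (v \in N /\ forall u, u \in N -> u.+1 <> v) (v \in starts N).
Proof.
rewrite inE; apply: (iffP andP) => -[vN st]; split=> //.
  by move=> u uN; apply/eqP; apply: (forall_inP st).
by apply/forall_inP=> u /st/eqP.
Qed.

Lemma consecutiveP A :
  reflect (forall i j k : 'I_(2 * n), i \in A -> k \in A -> i <= j <= k -> j \in A)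
          (consecutive A).
Proof.
apply: (iffP forall_inP) => [H i j k iA kA ijk|H i iA].
  have /forall_inP/(_ k kA)/forallP/(_ j) := H i iA.
  by rewrite ijk.
by apply/forall_inP=> k kA; apply/forallP=> j; apply/implyP; apply: H.
Qed.

Lemma runsP N A : A \in runs N -> [/\ A != set0, consecutive A & A \subset N].
Proof. by rewrite inE => /maxsetp/and3P. Qed.

Lemma run_maximal N A B : A \in runs N -> B != set0 -> consecutive B ->
  B \subset N -> A \subset B -> B = A.
Proof. by rewrite inE => /maxsetP[_ maxA] *; apply: maxA => //; apply/and3P. Qed.

Lemma consecutiveU A B v : consecutive A -> consecutive B ->
  v \in A -> v \in B -> consecutive (A :|: B).
Proof.
move=> /consecutiveP cA /consecutiveP cB vA vB; apply/consecutiveP=> i j k.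
rewrite !inE => iAB kAB /andP[ij jk].
case: (leqP j v) => [jv|/ltnW vj].
  case/orP: iAB => [iA|iB]; first by rewrite (cA i _ v) ?ij.
  by rewrite orbC (cB i _ v) ?ij.
case/orP: kAB => [kA|kB]; first by rewrite (cA v _ k) ?vj.
by rewrite orbC (cB v _ k) ?vj.
Qed.

(** Two runs that meet have a consecutive union, so by maximality they are
    equal. *)
Lemma runs_partition N : partition (runs N) N.
Proof.
apply/and3P; split.
- apply/eqP/setP=> v; apply/bigcupP/idP=> [[A /runsP[_ _ /subsetP]]|vN].
    exact.
  have [A maxA vA] : {A | maxset (fun A' : {set 'I_(2 * n)} =>
      [&& A' != set0, consecutive A' & A' \subset N]) A & [set v] \subset A}.
    apply: maxset_exists; rewrite sub1set vN andbT; apply/andP; split.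
      by apply/set0Pn; exists v; apply/set11.
    apply/consecutiveP=> i j k /set1P-> /set1P->.
    by rewrite -eqn_leq => /eqP vj; apply/set1P/val_inj.
  by exists A; rewrite ?inE // -sub1set.
- apply/trivIsetP=> A B rA rB; apply: contraNT => /pred0Pn[v /andP[/= vA vB]].
  have [[A0 cA AN] [B0 cB BN]] := (runsP rA, runsP rB).
  have cU := consecutiveU cA cB vA vB.
  have UN : A :|: B \subset N by rewrite subUset AN.
  have U0 : A :|: B != set0 by apply/set0Pn; exists v; rewrite inE vA.
  have UA := run_maximal rA U0 cU UN (subsetUl A B).
  by rewrite -{1}UA (run_maximal rB U0 cU UN (subsetUr A B)).
by apply/negP=> /runsP[]; rewrite eqxx.
Qed.

(** The start of a run is its minimum: a predecessor in N would extend the run,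
    and any later element has its predecessor in the run. *)
Lemma run_starts N A : A \in runs N -> \sum_(v in A) (v \in starts N) = 1.
Proof.
move=> rA; have [/set0Pn[v0 v0A] /consecutiveP cA /subsetP AN] := runsP rA.
case: (@arg_minnP _ v0 (mem A) (@nat_of_ord _) v0A) => a aA amin.
have start_a : a \in starts N.
  apply/startsP; split=> [|u uN ua]; first exact: AN.
  have cU : consecutive (u |: A).
    apply/consecutiveP=> i j k; rewrite !inE => iuA kuA /andP[ij jk].
    case: (ltngtP j u) => [ju|uj|/val_inj ->]; last by rewrite eqxx.
      case/orP: iuA => [/eqP iu|/amin ai]; last by lia.
      by move: ij; rewrite iu leqNgt ju.
    case/orP: kuA => [/eqP ku|kA]; first by move: jk; rewrite ku leqNgt uj.
    by rewrite (cA a j k) ?orbT // -ua uj.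
  have U0 : u |: A != set0 by apply/set0Pn; exists u; apply: setU11.
  have UN : u |: A \subset N.
    by apply/subsetP=> w /setU1P[->|/AN].
  have /amin : u \in A by rewrite -(run_maximal rA U0 cU UN) ?setU11 ?subsetU1.
  by rewrite -ua ltnn.
rewrite (bigD1 a) //= start_a big1 // => b /andP[bA ba].
apply/eqP; rewrite eqb0; apply/startsP=> -[_ stb].
have ab : a < b by rewrite ltn_neqAle (amin b bA) andbT eq_sym.
have b1lt : b.-1 < 2 * n by have := ltn_ord b; lia.
apply: (stb (Ordinal b1lt)) => /=; last by lia.
by apply/AN/(cA a _ b) => //=; lia.
Qed.

Lemma card_runs N : #|runs N| = #|starts N|.
Proof.
rewrite -sum1_card -(eq_bigr _ (@run_starts N)).
have /and3P[/eqP covN trivN _] := runs_partition N.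
rewrite -(big_trivIset _ trivN) covN -big_mkcondr /= sum1dep_card.
by congr #|pred_of_set _|; apply/setP=> v; rewrite !inE andbA andbb.
Qed.

End Runs.

(** * Short chords and starts of bubbles *)

Section ShortChords.
Variable n : nat.
Implicit Types (M : {set {set 'I_(2 * n)}}) (v : 'I_(2 * n)).

Definition free M : {set 'I_(2 * n)} := [set v | ~~ short_endpoint M v].

Definition diagrams : {set {set {set 'I_(2 * n)}}} :=
  matchings [set: 'I_(2 * n)].

Lemma bubbles_runs M : [set A | bubble M A] = runs (free M).
Proof.
apply/setP=> A; rewrite !inE; apply: maxset_eq => B; congr [&& _, _ & _].
apply/forall_inP/subsetP=> H v vB; first by rewrite inE H.
by have := H v vB; rewrite inE.
Qed.

(** The pair of adjacent vertices i, i+1.  The index is a natural number so that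
    [link] is total: past the end of the diagram it has at most one element, and
    then it cannot be a chord. *)
Definition link i : {set 'I_(2 * n)} :=
  [set v : 'I_(2 * n) | (v == i :> nat) || (v == i.+1 :> nat)].

Lemma linkE (i j : 'I_(2 * n)) : j = i.+1 :> nat -> link i = [set i; j].
Proof. by move=> ji; apply/setP=> v; rewrite !inE -ji. Qed.

Lemma card_link i : i.+1 < 2 * n -> #|link i| = 2.
Proof.
move=> ilt; rewrite (@linkE (Ordinal (ltnW ilt)) (Ordinal ilt)) //.
by rewrite cards2 -val_eqE /= neq_ltn ltnSn.
Qed.

Lemma link_bound M i : M \in diagrams -> link i \in M -> i.+1 < 2 * n.
Proof.
move=> MD /(card_chord MD) card2; rewrite ltnNge; apply/negP => ige.
suff : #|link i| <= 1 by rewrite card2.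
apply/card_le1_eqP=> u v; rewrite !inE => ui vi; apply: val_inj => /=.
have := ltn_ord u; have := ltn_ord v; lia.
Qed.

(** Adjacent pairs {i,i+1} and {i+1,i+2} share a vertex, so they cannot both be
    chords. *)
Lemma link_gap M i j : M \in diagrams -> link i \in M -> link j \in M ->
  i < j -> i.+1 < j.
Proof.
move=> MD iM jM ij; rewrite ltn_neqAle ij andbT; apply/eqP => defj.
have jlt := link_bound MD jM; have ilt : i < 2 * n by lia.
have eqij : link i = link j.
  by apply: (chord_eq (v := Ordinal (ltnW jlt)) MD) => //; rewrite inE /=; lia.
have : Ordinal ilt \in link j by rewrite -eqij inE /= eqxx.
by rewrite inE /=; lia.
Qed.

Lemma free_link M v : M \in diagrams ->
  (v \in free M) = (link v \notin M) && ((0 < v) ==> (link v.-1 \notin M)).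
Proof.
move=> MD; rewrite inE -[RHS]negbK; congr (~~ _).
apply/exists_inP/idP => [[c cM /andP[/existsP[i /existsP[j]]]]|].
  case/andP=> /eqP ji /eqP defc; rewrite defc -(linkE ji) inE.
  rewrite negb_and negb_imply !negbK; case/orP=> /eqP->.
    by rewrite (linkE ji) -defc cM.
  by rewrite /= orbC (linkE ji) -defc cM.
have short_link i : link i \in M -> short (link i).
  move=> iM; have ilt := link_bound MD iM.
  apply/existsP; exists (Ordinal (ltnW ilt)); apply/existsP.
  by exists (Ordinal ilt); rewrite eqxx -linkE ?eqxx.
rewrite negb_and negb_imply !negbK => /orP[vM|/andP[v0 vM]].
  by exists (link v); rewrite // short_link // inE eqxx.
by exists (link v.-1); rewrite // short_link // inE prednK // eqxx orbT.
Qed.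

Lemma card_diagrams : #|diagrams| = odd_factorial n.
Proof. by apply: card_matchings; rewrite cardsT card_ord mul2n. Qed.

Lemma count_link i : i.+1 < 2 * n ->
  \sum_(M in diagrams) (link i \in M) = odd_factorial n.-1.
Proof.
move=> ilt; have c2 := card_link ilt.
rewrite -big_mkcondr sum1dep_card card_matchings_with ?subsetT //.
apply: card_matchings; move: (cardsD [set: 'I_(2 * n)] (link i)).
by rewrite setTI c2 cardsT card_ord => ->; lia.
Qed.

Lemma count_link2 i j : i.+1 < j -> j.+1 < 2 * n ->
  \sum_(M in diagrams) ((link i \in M) && (link j \in M)) = odd_factorial n.-2.
Proof.
move=> ij jlt; have i2 : #|link i| = 2 by apply: card_link; lia.
have j2 := card_link jlt.
have jS : link j \subset setT :\: link i.
  by apply/subsetP=> v; rewrite !inE andbT; lia.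
rewrite -big_mkcondr sum1dep_card card_matchings_with2 ?subsetT //.
apply: card_matchings; move: (cardsD [set: 'I_(2 * n)] (link i)).
rewrite setTI i2 cardsT card_ord => ci.
by move: (cardsD (setT :\: link i) (link j)); rewrite (setIidPr jS) j2 ci; lia.
Qed.

(** A vertex is free, or the left end of a short chord, or the right end of one,
    and these cases exclude each other. *)
Lemma count_free v :
  \sum_(M in diagrams) (v \in free M)
    + (0 < v) * odd_factorial n.-1 + (v.+1 < 2 * n) * odd_factorial n.-1
  = odd_factorial n.
Proof.
have -> : (0 < v) * odd_factorial n.-1
    = \sum_(M in diagrams) ((0 < v) && (link v.-1 \in M)).
  case: posnP => [_|v0]; first by rewrite big1.
  by rewrite mul1n count_link // prednK.
have -> : (v.+1 < 2 * n) * odd_factorial n.-1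
    = \sum_(M in diagrams) (link v \in M).
  case: ltnP => [vlt|vge]; first by rewrite mul1n count_link.
  rewrite big1 // => M MD; apply/eqP; rewrite eqb0; apply/negP.
  by move/(link_bound MD); rewrite ltnNge vge.
rewrite -!big_split -card_diagrams -sum1_card; apply: eq_bigr => M MD.
have gap : 0 < v -> ~~ ((link v.-1 \in M) && (link v \in M)).
  move=> v0; apply/negP=> /andP[uM vM]; have := link_gap MD uM vM.
  by rewrite prednK // ltnn leqnn => /(_ isT).
rewrite free_link //; move: gap.
by case: (0 < v); case: (link v \in M); case: (link v.-1 \in M) => // /(_ isT).
Qed.

(** If v-1 is not free and v is, then the short chord through v-1 must go to the
    left. *)
Lemma start_link M v i : M \in diagrams -> v = i.+2 :> nat ->
  (v \in starts (free M)) = (link i \in M) && (link v \notin M).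
Proof.
move=> MD defv; have ult : i.+1 < 2 * n by have := ltn_ord v; lia.
apply/startsP/andP=> [[vf st]|[iM vM]].
  move: vf; rewrite free_link // defv /= => /andP[-> uM]; split=> //.
  apply: contraT => iM; case: (st (Ordinal ult)); last by rewrite defv.
  by rewrite free_link //= uM.
split.
  rewrite free_link // vM defv /=; apply/negP => uM.
  by have := link_gap MD iM uM (ltnSn i); rewrite ltnn.
move=> u uf uv; move: uf; rewrite free_link //.
have -> : u = i.+1 :> nat by lia.
by rewrite /= iM andbF.
Qed.

End ShortChords.

(** * Totals over all diagrams *)

Section Totals.
Variable n : nat.
Implicit Types (M : {set {set 'I_(2 * n)}}) (v : 'I_(2 * n)).

(** Sorting bubbles by size loses none of them, since all sizes lie between 1 and
    2n. *)
Lemma weighted_num_bubbles (F : nat -> nat) :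
  \sum_(1 <= p < (2 * n).+1) F p * num_bubbles n p
    = \sum_(M in diagrams n) \sum_(A in runs (free M)) F #|A|.
Proof.
under eq_bigr do rewrite /num_bubbles big_distrr.
rewrite exchange_big /=; apply: eq_big => [M|M _].
  by rewrite /diagrams /matchings inE.
rewrite -bubbles_runs.
transitivity (\sum_(1 <= p < (2 * n).+1)
    \sum_(A in [set A | bubble M A]) (if p == #|A| then F p else 0)).
  apply: eq_bigr => p _; rewrite -big_mkcondr /= sum_nat_const mulnC.
  congr (_ * _); apply: eq_card => A.
  by rewrite [RHS]unfold_in /= !inE eq_sym.
rewrite exchange_big /=; apply: eq_bigr => A; rewrite bubbles_runs => rA.
rewrite -big_mkcond big_nat1_eq ltnS.
have [A0 _ _] := runsP rA; have := max_card A.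
by rewrite card_gt0 A0 card_ord => ->.
Qed.

Lemma sum_bubble_sizes :
  \sum_(1 <= p < (2 * n).+1) p * num_bubbles n p
    = \sum_(M in diagrams n) #|free M|.
Proof.
rewrite (weighted_num_bubbles id); apply: eq_bigr => M _.
by rewrite -(card_partition (runs_partition _)).
Qed.

Lemma sum_num_bubbles :
  \sum_(1 <= p < (2 * n).+1) num_bubbles n p
    = \sum_(M in diagrams n) #|starts (free M)|.
Proof.
under eq_bigr do rewrite -[num_bubbles _ _]mul1n.
rewrite (weighted_num_bubbles (fun => 1)); apply: eq_bigr => M _.
by rewrite sum1_card card_runs.
Qed.

(** The three cases v = 0, v = 1 and v >= 2 are put in one formula so that it can
    be summed over all vertices.  Negative terms are moved to the left to stay in
    the natural numbers. *)
Lemma count_start v : 0 < n ->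
  \sum_(M in diagrams n) (v \in starts (free M))
    + (v == 0 :> nat) * odd_factorial n.-1
    + ((1 < v) && (v.+1 < 2 * n)) * odd_factorial n.-2
  = (v == 0 :> nat) * odd_factorial n + (1 < v) * odd_factorial n.-1.
Proof.
move=> n0; case defv: (nat_of_ord v) => [|[|i]] /=.
- rewrite !mul0n !addn0 !mul1n -(count_free v) defv mul0n addn0.
  have -> : 1 < 2 * n by lia.
  rewrite mul1n; congr (_ + _); apply: eq_bigr => M _; congr nat_of_bool.
  by apply/startsP/idP=> [[]//|vf]; split=> // u _; rewrite defv.
- rewrite !mul0n !addn0 big1 // => M MD; apply/eqP; rewrite eqb0.
  apply/startsP=> -[]; rewrite free_link // defv /= => /andP[_ lM] st.
  have u0 : 0 < 2 * n by lia.
  by case: (st (Ordinal u0)); rewrite // free_link //= andbT.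
rewrite !mul0n add0n addn0 mul1n -(@count_link n i); last first.
  by have := ltn_ord v; lia.
have -> : (i.+3 < 2 * n) * odd_factorial n.-2
    = \sum_(M in diagrams n) ((link n i \in M) && (link n v \in M)).
  case: ltnP => [vlt|vge]; first by rewrite mul1n count_link2 ?defv.
  rewrite big1 // => M MD; apply/eqP; rewrite eqb0; apply/negP.
  by case/andP=> _ /(link_bound MD); rewrite defv ltnNge vge.
rewrite -big_split; apply: eq_bigr => M MD.
by rewrite (start_link MD defv); case: (link n i \in M); case: (_ \in M).
Qed.

Lemma exchange_card (E : {set {set 'I_(2 * n)}} -> {set 'I_(2 * n)}) :
  \sum_(M in diagrams n) #|E M| = \sum_v \sum_(M in diagrams n) (v \in E M).
Proof.
rewrite exchange_big; apply: eq_bigr => M _.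
by rewrite -big_mkcond /= sum1_card.
Qed.

Lemma total_free :
  \sum_(M in diagrams n) #|free M| + 2 * (2 * n).-1 * odd_factorial n.-1
  = 2 * n * odd_factorial n.
Proof.
have <- : \sum_(v < 2 * n) odd_factorial n = 2 * n * odd_factorial n.
  by rewrite sum_nat_const card_ord.
rewrite -(eq_bigr _ (fun v _ => count_free v)).
rewrite !big_split -!big_distrl -exchange_card /=.
have -> : \sum_(v < 2 * n) (0 < v) = (2 * n).-1.
  by case: (2 * n) => [|m]; rewrite ?big_ord0 // big_ord_recl sum1_card card_ord.
have -> : \sum_(v < 2 * n) (v.+1 < 2 * n) = (2 * n).-1.
  case: (2 * n) => [|m]; first by rewrite big_ord0.
  rewrite big_ord_recr /= ltnn addn0 (eq_bigr (fun => 1)).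
    by rewrite sum1_card card_ord.
  by move=> i _; rewrite ltnS ltn_ord.
by lia.
Qed.

Lemma total_starts : 1 < n ->
  \sum_(M in diagrams n) #|starts (free M)|
    + odd_factorial n.-1 + (2 * n - 3) * odd_factorial n.-2
  = odd_factorial n + (2 * n - 2) * odd_factorial n.-1.
Proof.
move=> n1.
have: \sum_(v < 2 * n) _ = \sum_(v < 2 * n) _ :=
  eq_bigr _ (fun v _ => count_start v (ltnW n1)).
rewrite !big_split -!big_distrl -exchange_card /=.
have [k defk] : exists k, 2 * n = k.+3 by exists (2 * n - 3); lia.
have -> : \sum_(v < 2 * n) (v == 0 :> nat) = 1.
  by rewrite defk big_ord_recl big1.
have -> : \sum_(v < 2 * n) (1 < v) = 2 * n - 2.
  by rewrite defk !big_ord_recl /= sum1_card card_ord; lia.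
have -> : \sum_(v < 2 * n) ((1 < v) && (v.+1 < 2 * n)) = 2 * n - 3.
  rewrite defk 2!big_ord_recl big_ord_recr /= ltnn addn0 (eq_bigr (fun => 1)).
    by rewrite sum1_card card_ord; lia.
  by move=> i _; rewrite /= !ltnS; have := ltn_ord i; rewrite /bump /=; lia.
by rewrite !mul1n.
Qed.

End Totals.

Lemma odd_factorialS m : odd_factorial m.+1 = m.*2.+1 * odd_factorial m.
Proof. by rewrite /odd_factorial big_ord_recr mulnC. Qed.

Lemma odd_factorial_gt0 m : 0 < odd_factorial m.
Proof. exact: prodn_gt0. Qed.

Import GRing.Theory.
Local Open Scope ring_scope.

Theorem theorem5 (n : nat) (hn : (0 < n)%N) :
  (\sum_(1 <= p < (2 * n).+1) p%:R * (num_bubbles n p)%:R)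
    / (\sum_(1 <= p < (2 * n).+1) (num_bubbles n p)%:R)
  = 2 * (2 * n%:R - 1) * (n%:R - 1) / (4 * n%:R - 5) :> rat.
Proof.
under eq_bigr do rewrite -natrM.
rewrite -!natr_sum sum_bubble_sizes sum_num_bubbles.
have tf := total_free n; have ts := @total_starts n.
case: n hn tf ts => [//|[|k]] _ tf ts.
  (* The right-hand side vanishes through its factor n - 1. *)
  have -> : (\sum_(M in diagrams 1) #|free M| = 0)%N.
    by move: tf; rewrite /= odd_factorialS /odd_factorial !big_ord0; lia.
  by rewrite mul0r subrr mulr0 mul0r.
move: tf (ts isT) => {ts} /=; set a := (\sum_(M in _) _)%N.
set b := (\sum_(M in _) _)%N => tf ts.
have D0 := odd_factorial_gt0 k.+1; set d := odd_factorial k.+1 in D0 tf ts.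
have defa : a = (2 * k.+1 * (2 * k + 3) * d)%N.
  by move: tf; rewrite odd_factorialS -/d; lia.
have defb : b = ((4 * k + 3) * d)%N.
  have : (d = (2 * k + 1) * odd_factorial k)%N.
    by rewrite /d odd_factorialS; lia.
  by move: ts; rewrite odd_factorialS -/d; nia.
have d0 : d%:R != 0 :> rat by rewrite Num.Theory.pnatr_eq0 -lt0n.
rewrite defa defb !natrM.
have k0 : (4 * k + 3)%:R != 0 :> rat by rewrite Num.Theory.pnatr_eq0; lia.
have k0' : 4 * k.+2%:R - 5 != 0 :> rat.
  by move: k0; apply: contra => /eqP H; apply/eqP; move: H; rewrite natrD natrM -(addn2 k) natrD; lra.
apply/eqP; rewrite eqr_div ?mulf_neq0 //; apply/eqP.
rewrite -(addn2 k) -(addn1 k) !natrD; ring.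
Qed.
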